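(* Let $n\ge 1$ be an integer and let $f:(0,\infty)\to\mathbb{R}$ be a continuous and (strictly) increasing function. Then the energy $E^f_n$ attains its maximum on $\mathcal{G}_n$; that is, there exists $G_n^*\in\mathcal{G}_n$ with $E^f_n(G_n)\le E^f_n(G_n^* )$ for all $G_n\in\mathcal{G}_n$.
   Context: $\mathcal{G}_n$ is the set of all non-extensible flexible closed curves $G_n$ of length $n$ in $\mathbb{R}^3$ carrying $n$ particles (called vertices) $A_1,\dots,A_n$ evenly fixed along the curve with respect to arc length. Explicitly, $G_n$ is given by an $n$-periodic map $c:\mathbb{R}\to\mathbb{R}^3$ parametrized by arc length (the length of $c|_{[s,t]}$ is $t-s$ for all $s<t$), and $A_i=c(i)$. Indices are cyclic, $A_{n+1}=A_1$. The vertex positions that occur are exactly the tuples $(A_1,\dots,A_n)\in(\mathbb{R}^3)^n$ with $|A_iA_{i+1}|\le 1$ for all $i$ (cyclically), where $|A_pA_q|$ is the Euclidean distance. The energy is $E^f_n(G_n)=\sum_{1\le p<q\le n} f(|A_pA_q|)$, which depends only on the vertex positions. Vertices may coincide; the value $f(0)$ is understood as $\lim_{x\to 0^+}f(x)\in[-\infty,\infty)$, so that $E^f_n$ takes values in $[-\infty,\infty)$. *)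

(* Defs.v *)
From mathcomp Require Import all_boot all_order all_algebra.
From mathcomp Require Import all_classical all_reals all_analysis.
Set Implicit Arguments.
Unset Strict Implicit.
Unset Printing Implicit Defensive.
Import Order.TTheory GRing.Theory Num.Theory.
Import numFieldNormedType.Exports.
Local Open Scope classical_set_scope.
Local Open Scope ring_scope.

(* The norm that MathComp-Analysis puts on 'rV[R]_3 is the sup norm, so the
   Euclidean distance is defined separately. *)
Definition eucl_dist (R : realType) (x y : 'rV[R]_3) : R :=
  Num.sqrt (\sum_(i < 3) (x 0 i - y 0 i) ^+ 2).

(* Vector-valued, Euclidean analogue of [variation]: as for [itv_partition], the
   subdivision a = t_0 < t_1 < ... < t_k = b is represented by [t_1; ...; t_k]. *)
Definition polygon_length (R : realType) (c : R -> 'rV[R]_3) (a b : R)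
    (s : seq R) : R :=
  \sum_(0 <= k < size s) eucl_dist (c (nth b (a :: s) k)) (c (nth b (a :: s) k.+1)).

Definition curve_length (R : realType) (c : R -> 'rV[R]_3) (a b : R) : \bar R :=
  ereal_sup [set (polygon_length c a b s)%:E | s in itv_partition a b].

Definition closed_curves (R : realType) (n : nat) : set (R -> 'rV[R]_3) :=
  [set c | periodic c n%:R /\
           forall s t : R, s < t -> curve_length c s t = (t - s)%:E].

Definition vertex (R : realType) (c : R -> 'rV[R]_3) (i : nat) : 'rV[R]_3 :=
  c i%:R.

(* Extension to [0, +oo[ of a function on ]0, +oo[ by its right limit at 0,
   which may be -oo; the values of f outside ]0, +oo[ are irrelevant. *)
Definition extend0 (R : realType) (f : R -> R) (x : R) : \bar R :=
  if 0 < x then (f x)%:E else lim ((f y)%:E @[y --> 0^'+]).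

Definition energy (R : realType) (f : R -> R) (n : nat)
    (c : R -> 'rV[R]_3) : \bar R :=
  (\sum_(1 <= p < n.+1) \sum_(p.+1 <= q < n.+1)
     extend0 f (eucl_dist (vertex c p) (vertex c q)))%E.

(* Main.v *)
(* The energy depends only on the vertices and is translation invariant, so one
   may put the vertex of index 0 at the origin; the admissible vertex tuples then
   form a compact set. Since [f] is increasing, it has a right limit at 0 that is
   not +oo, so its extension is continuous with values in [-oo, +oo[ and so is
   the energy: it attains its maximum. Conversely, every admissible tuple is
   realized by a curve: insert between consecutive vertices a point at distance
   1/2 from both, and follow the resulting closed polygon at unit speed. *)
Require Import Defs.
From mathcomp Require Import all_boot all_order all_algebra.
From mathcomp Require Import all_classical all_reals all_analysis.
From mathcomp Require Import ring lra zify.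
Import Order.TTheory GRing.Theory Num.Theory.
Import numFieldNormedType.Exports.
Local Open Scope classical_set_scope.
Local Open Scope ring_scope.

(** * Euclidean geometry of ['rV[R]_3] *)

Section Euclidean.
Context {R : realType}.
Implicit Types x y z v : 'rV[R]_3.

Lemma eucl_distE x y : eucl_dist x y =
  Num.sqrt ((x 0 0 - y 0 0) ^+ 2 + (x 0 1 - y 0 1) ^+ 2
            + (x 0 2%:R - y 0 2%:R) ^+ 2).
Proof.
rewrite /eucl_dist !big_ord_recr big_ord0 /= add0r.
by congr (Num.sqrt (_ + _ + _)); congr ((x 0 _ - y 0 _) ^+ 2); apply/val_inj.
Qed.

Lemma eucl_dist_ge0 x y : 0 <= eucl_dist x y.
Proof. exact: sqrtr_ge0. Qed.

Lemma eucl_distxx x : eucl_dist x x = 0.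
Proof.
by rewrite /eucl_dist big1 ?sqrtr0 // => i _; rewrite subrr expr0n.
Qed.

Lemma eucl_dist_translate x y v : eucl_dist (x + v) (y + v) = eucl_dist x y.
Proof.
rewrite /eucl_dist; congr Num.sqrt; apply: eq_bigr => i _.
by rewrite !mxE; ring.
Qed.

Lemma coord_le_eucl_dist x y i : `|x 0 i - y 0 i| <= eucl_dist x y.
Proof.
rewrite -sqrtr_sqr ler_sqrt; last by apply: sumr_ge0 => j _; exact: sqr_ge0.
by rewrite (bigD1 i) //= lerDl; apply: sumr_ge0 => j _; exact: sqr_ge0.
Qed.

(** Squaring both sides reduces the inequality to Cauchy-Schwarz for the difference vectors
    ([CS]). *)
Lemma eucl_dist_triangle x y z :
  eucl_dist x z <= eucl_dist x y + eucl_dist y z.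
Proof.
have sq (u w : 'rV[R]_3) : eucl_dist u w ^+ 2 =
    (u 0 0 - w 0 0) ^+ 2 + (u 0 1 - w 0 1) ^+ 2 + (u 0 2%:R - w 0 2%:R) ^+ 2.
  by rewrite eucl_distE sqr_sqrtr // !addr_ge0 ?sqr_ge0.
have sqD := ler_pXn2r (n := 2) isT.
rewrite -[_ <= _]sqD ?nnegrE ?addr_ge0 ?eucl_dist_ge0 // sqrrD !sq.
set a := _ - y 0 0; set b := _ - y 0 1; set c := _ - y 0 2%:R.
set a' := y 0 0 - z 0 0; set b' := y 0 1 - z 0 1; set c' := y 0 2%:R - z 0 2%:R.
have -> : x 0 0 - z 0 0 = a + a' by rewrite /a /a'; ring.
have -> : x 0 1 - z 0 1 = b + b' by rewrite /b /b'; ring.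
have -> : x 0 2%:R - z 0 2%:R = c + c' by rewrite /c /c'; ring.
have CS : a * a' + b * b' + c * c' <= eucl_dist x y * eucl_dist y z.
  apply: le_trans (ler_norm _) _.
  rewrite -[_ <= _]sqD ?nnegrE ?mulr_ge0 ?eucl_dist_ge0 // real_normK ?num_real //.
  rewrite exprMn !sq -/a -/b -/c -/a' -/b' -/c' -subr_ge0.
  (* Lagrange's identity: the defect in Cauchy-Schwarz is the squared norm of the cross product. *)
  rewrite [leRHS](_ : _ = (a * b' - b * a') ^+ 2 + (a * c' - c * a') ^+ 2
    + (b * c' - c * b') ^+ 2); last by ring.
  by rewrite !addr_ge0 ?sqr_ge0.
nra.
Qed.

Lemma eucl_dist_line x v a b :
  eucl_dist (x + a *: v) (x + b *: v) = `|a - b| * eucl_dist v 0.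
Proof.
rewrite -sqrtr_sqr /eucl_dist -sqrtrM ?sqr_ge0 // mulr_sumr; congr Num.sqrt.
by apply: eq_bigr => i _; rewrite !mxE; ring.
Qed.

Lemma eucl_distB x y : eucl_dist (y - x) 0 = eucl_dist x y.
Proof.
by rewrite /eucl_dist; congr Num.sqrt; apply: eq_bigr => i _; rewrite !mxE; ring.
Qed.

(** If [v] lies on the third axis, the first basis vector works; otherwise the projection of [v] to
    the first two coordinates is turned by a right angle and normalized. *)
Lemma exists_orthogonal_unit v :
  exists u : 'rV[R]_3, v 0 0 * u 0 0 + v 0 1 * u 0 1 + v 0 2%:R * u 0 2%:R = 0
    /\ u 0 0 ^+ 2 + u 0 1 ^+ 2 + u 0 2%:R ^+ 2 = 1.
Proof.
pose r := v 0 0 ^+ 2 + v 0 1 ^+ 2.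
have r_ge0 : 0 <= r by rewrite addr_ge0 ?sqr_ge0.
have [r0|r_neq0] := eqVneq r 0.
  exists (delta_mx 0 0); move/eqP: r0; rewrite paddr_eq0 ?sqr_ge0 // !sqrf_eq0.
  by move=> /andP[/eqP-> /eqP->]; rewrite !mxE /=; split; ring.
have s2 : Num.sqrt r ^+ 2 = r by rewrite sqr_sqrtr.
have s_neq0 : Num.sqrt r != 0 by rewrite -(sqrf_eq0 (Num.sqrt r)) s2.
exists (\row_i (if i == 0 then - v 0 1 / Num.sqrt r
                else if i == 1 then v 0 0 / Num.sqrt r else 0)).
rewrite !mxE /=; split; first by field.
by rewrite !expr_div_n s2 sqrrN expr0n addr0 -mulrDl addrC divff.
Qed.

(** The apex is the midpoint of [x] and [y] moved by the height [h] along a unit vector orthogonal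
    to [y - x]. Pythagoras dictates [h], and the bound on the distance makes the radicand
    nonnegative. The case [x = y] is covered too. *)
Lemma exists_isosceles_apex x y : eucl_dist x y <= 1 ->
  exists m, eucl_dist x m = 2^-1 /\ eucl_dist m y = 2^-1.
Proof.
move=> xy1; have [u [uv u1]] := exists_orthogonal_unit (y - x).
pose d := eucl_dist x y; pose h := Num.sqrt ((1 - d ^+ 2) / 4).
have d2 : d ^+ 2 = (x 0 0 - y 0 0) ^+ 2 + (x 0 1 - y 0 1) ^+ 2
    + (x 0 2%:R - y 0 2%:R) ^+ 2.
  by rewrite /d eucl_distE sqr_sqrtr // !addr_ge0 ?sqr_ge0.
have h2 : h ^+ 2 = (1 - d ^+ 2) / 4.
  rewrite sqr_sqrtr // divr_ge0 // subr_ge0 expr_le1 //; exact: eucl_dist_ge0.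
rewrite !mxE in uv.
(* Expanded squared distance from the apex to an endpoint: [a] stands for the inner product with
   [u], up to sign, [b] for the squared base and [c] for the squared norm of [u]. *)
have half a b c : a = 0 -> b = d ^+ 2 -> c = 1 ->
    Num.sqrt (h ^+ 2 * c + b / 4 + h * a) = 2^-1.
  move=> -> -> ->; rewrite h2 [X in Num.sqrt X](_ : _ = 2^-1 ^+ 2); last by field.
  by rewrite sqrtr_sqr ger0_norm.
exists (2^-1 *: (x + y) + h *: u); rewrite !eucl_distE !mxE; split.
  by rewrite -[RHS](half _ _ _ uv (esym d2) u1); congr Num.sqrt; field.
by rewrite -[RHS](half _ _ _ (etrans (congr1 -%R uv) (oppr0 _)) (esym d2) u1);
  congr Num.sqrt; field.
Qed.

End Euclidean.

(** * Inscribed polygons and arc length *)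

Section PolygonLength.
Context {R : realType}.
Implicit Types (c : R -> 'rV[R]_3) (a b t : R) (s : seq R).

Lemma polygon_length_cons c a b t s : polygon_length c a b (t :: s) =
  eucl_dist (c a) (c t) + polygon_length c t b s.
Proof. by rewrite /polygon_length /= big_nat_recl. Qed.

Lemma polygon_length_nil c a b : polygon_length c a b [::] = 0.
Proof. by rewrite /polygon_length big_geq. Qed.

Lemma itv_partition_consE a b t s :
  itv_partition a b (t :: s) <-> a < t /\ itv_partition t b s.
Proof.
rewrite /itv_partition /=; split; first by move=> [/andP[]].
by move=> [-> []].
Qed.

Lemma eucl_dist_le_curve_length c a b : a < b ->
  ((eucl_dist (c a) (c b))%:E <= curve_length c a b)%E.
Proof.
move=> ab; apply: ereal_sup_ubound; exists [:: b]; first exact: itv_partition1.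
by rewrite polygon_length_cons polygon_length_nil addr0.
Qed.

Lemma polygon_length_ge c a b s : itv_partition a b s ->
  eucl_dist (c a) (c b) <= polygon_length c a b s.
Proof.
elim: s a => [a /itv_partition_nil -> |t s IH a /itv_partition_consE[_ /IH tb]].
  by rewrite polygon_length_nil eucl_distxx.
rewrite polygon_length_cons; apply: le_trans (eucl_dist_triangle _ (c t) _) _.
by rewrite lerD2l.
Qed.

Lemma polygon_length_le c a b s :
  (forall t u, t < u -> eucl_dist (c t) (c u) <= u - t) ->
  itv_partition a b s -> polygon_length c a b s <= b - a.
Proof.
move=> lip; elim: s a => [a /itv_partition_nil ->|t s IH a].
  by rewrite polygon_length_nil subrr.
move=> /itv_partition_consE[/lip at1 /IH tb]; rewrite polygon_length_cons; lra.
Qed.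

(** A single subdivision of full length on each interval suffices: since a chord is no longer than
    an inscribed polygon, it makes [c] 1-Lipschitz, and this bounds all other subdivisions by
    [b - a]. *)
Lemma curve_length_eq c a b :
  (forall t u, t < u -> exists2 s, itv_partition t u s &
    polygon_length c t u s = u - t) ->
  a < b -> curve_length c a b = (b - a)%:E.
Proof.
move=> full ab; apply/eqP; rewrite eq_le; apply/andP; split.
  apply: ge_ereal_sup => _ [s sab <-]; rewrite lee_fin.
  apply: polygon_length_le => // t u /full[r rtu <-]; exact: polygon_length_ge.
have [s sab <-] := full _ _ ab.
by apply: ereal_sup_ubound; exists s.
Qed.

End PolygonLength.

(** * Unit speed polygons with edges of length 1/2, and curves through given points *)

Section PolygonalCurve.
Context {R : realType} (P : int -> 'rV[R]_3).

(** The corner [P k] is passed at time [k / 2], so edges of length 1/2 give unit speed. Indexing by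
    [int] lets the curve be defined on all of [R]. *)
Definition polygonal_curve (t : R) : 'rV[R]_3 :=
  let k := Num.floor (2 * t) in P k + (2 * t - k%:~R) *: (P (k + 1) - P k).

(** The affine formula also holds at the right end of its piece, where the floor has already jumped,
    because consecutive pieces share a corner. *)
Lemma polygonal_curve_seg (k : int) (t : R) :
  k%:~R <= 2 * t <= (k + 1)%:~R ->
  polygonal_curve t = P k + (2 * t - k%:~R) *: (P (k + 1) - P k).
Proof.
move=> /andP[kt]; rewrite le_eqVlt => /predU1P[tk|tk].
  rewrite /polygonal_curve tk intrKfloor subrr scale0r addr0.
  by rewrite [_ - k%:~R](_ : _ = 1) ?intrD; [rewrite scale1r [RHS]addrC subrK | ring].
by rewrite /polygonal_curve (floor_def (m := k)) // kt.
Qed.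

Lemma polygonal_curve_node (k : int) : polygonal_curve (k%:~R / 2) = P k.
Proof.
rewrite (@polygonal_curve_seg k) mulrC divfK //; last by rewrite lexx ler_int lerDl.
by rewrite subrr scale0r addr0.
Qed.

Lemma polygonal_curve_periodic (m : nat) :
  (forall k, P (k + m.*2%:Z) = P k) -> periodic polygonal_curve m%:R.
Proof.
move=> Pm t; rewrite /polygonal_curve.
have -> : 2 * (t + m%:R) = 2 * t + (m.*2%:Z)%:~R :> R.
  by rewrite -muln2 PoszM intrM; ring.
have Pm1 k : P (k + m.*2%:Z + 1) = P (k + 1) by rewrite addrAC Pm.
rewrite floorDrz ?intr_int // intrKfloor Pm1 Pm intrD; congr (_ + _ *: _).
by ring.
Qed.

Hypothesis Pstep : forall k, eucl_dist (P k) (P (k + 1)) = 2^-1.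

Lemma polygonal_curve_isometric (k : int) (s t : R) :
  k%:~R <= 2 * s -> s <= t -> 2 * t <= (k + 1)%:~R ->
  eucl_dist (polygonal_curve s) (polygonal_curve t) = t - s.
Proof.
move=> ks st tk; rewrite !(@polygonal_curve_seg k); try by apply/andP; split; lra.
rewrite eucl_dist_line eucl_distB Pstep distrC ger0_norm; lra.
Qed.

(* The corners strictly between [s] and [t] subdivide [s, t] into pieces on
   which the curve is isometric. *)
Lemma polygonal_curve_partition (s t : R) : s < t ->
  exists2 p, itv_partition s t p & polygon_length polygonal_curve s t p = t - s.
Proof.
move=> st.
(* [m] bounds the number of corners strictly between [s] and [t]. The induction on [m] moves [s] to
   the next corner [u]. *)
have [m tm] : exists m : nat, 2 * t <= (Num.floor (2 * s) + 1 + m%:Z)%:~R.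
  exists (Num.bound (2 * t - 2 * s)); rewrite intrD -pmulrn.
  have /archi_boundP : 0 <= 2 * t - 2 * s by lra.
  by have := floorD1_gt (2 * s); lra.
elim: m s st tm => [|m IH] s st.
  rewrite addr0 => tm; exists [:: t]; first exact: itv_partition1.
  rewrite polygon_length_cons polygon_length_nil addr0.
  by apply: polygonal_curve_isometric (floor_le _) (ltW st) tm.
set k := Num.floor (2 * s); move=> tm.
have ks : k%:~R <= 2 * s := floor_le _.
have sk : 2 * s < (k + 1)%:~R := floorD1_gt _.
have [tk|kt] := leP (2 * t) (k + 1)%:~R.
  exists [:: t]; first exact: itv_partition1.
  rewrite polygon_length_cons polygon_length_nil addr0.
  exact: polygonal_curve_isometric ks (ltW st) tk.
pose u : R := (k + 1)%:~R / 2.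
have u2 : 2 * u = (k + 1)%:~R by rewrite /u mulrC divfK.
have [||p pP pE] := IH u; first by rewrite /u; lra.
  by rewrite u2 intrKfloor (_ : k + 1 + 1 + m%:Z = k + 1 + m.+1%:Z) //; lia.
exists (u :: p); first by rewrite itv_partition_consE; split=> //; rewrite /u; lra.
rewrite polygon_length_cons pE (@polygonal_curve_isometric k) ?u2 //; last first.
  by rewrite /u; lra.
by rewrite addrC subrKA.
Qed.

Lemma polygonal_curve_closed (m : nat) :
  (forall k, P (k + m.*2%:Z) = P k) -> closed_curves m polygonal_curve.
Proof.
move=> Pm; split; first exact: polygonal_curve_periodic.
move=> s t; apply: curve_length_eq; exact: polygonal_curve_partition.
Qed.

End PolygonalCurve.

Lemma exists_closed_curve_through {R : realType} (n : nat) (A : int -> 'rV[R]_3) :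
  (forall k, A (k + n%:Z) = A k) ->
  (forall k, eucl_dist (A k) (A (k + 1)) <= 1) ->
  exists2 c, closed_curves n c & forall k : nat, vertex c k = A k.
Proof.
move=> An A1.
(* The apex is chosen as a function of the two endpoints rather than of the index, so that it
   inherits the periodicity of [A]. The default 0 is for endpoints too far apart, which [A1]
   excludes. *)
have /choice[apex apexP] (p : 'rV[R]_3 * 'rV[R]_3) : exists m,
    eucl_dist p.1 p.2 <= 1 -> eucl_dist p.1 m = 2^-1 /\ eucl_dist m p.2 = 2^-1.
  have [/exists_isosceles_apex[m mP]|p1] := leP (eucl_dist p.1 p.2) 1.
    by exists m.
  by exists 0.
(* Even corners are the given points, odd corners the apexes between them; hence [A k] is the corner
   of index [2 * k], reached at time [k]. *)
pose P (k : int) := if (k %% 2)%Z == 0 then A (k %/ 2)%Z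
                    else apex (A (k %/ 2)%Z, A ((k %/ 2)%Z + 1)).
exists (polygonal_curve P).
  apply: polygonal_curve_closed => k.
    rewrite /P; have [k0|k0] := eqVneq (k %% 2)%Z 0.
      have -> : ((k + 1) %% 2)%Z = 1 by clear -k0; lia.
      have -> : ((k + 1) %/ 2)%Z = (k %/ 2)%Z by clear -k0; lia.
      by have [] := apexP (A (k %/ 2)%Z, A ((k %/ 2)%Z + 1)) (A1 _).
    have -> : ((k + 1) %% 2)%Z = 0 by clear -k0; lia.
    have -> : ((k + 1) %/ 2)%Z = (k %/ 2)%Z + 1 by clear -k0; lia.
    by have [] := apexP (A (k %/ 2)%Z, A ((k %/ 2)%Z + 1)) (A1 _).
  have shift : ((k + n.*2%:Z) %/ 2)%Z = (k %/ 2)%Z + n%:Z by clear; lia.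
  have parity : ((k + n.*2%:Z) %% 2)%Z = (k %% 2)%Z by clear; lia.
  by rewrite /P shift parity An addrAC An.
move=> k; rewrite /vertex; have -> : k%:R = (k%:Z * 2)%:~R / 2 :> R.
  by rewrite intrM mulfK.
by rewrite polygonal_curve_node /P modzMl mulzK.
Qed.

(** * Continuity and maxima of functions with extended real values *)

Lemma contract_continuous {R : realType} : continuous (@contract R).
Proof.
move=> x; apply/cvgrPdist_lt => e e0.
have : nbhs x (ball x e) by exact: nbhsx_ballx.
(* Balls of [\bar R] are by definition measured after applying [contract]. *)
by apply: filterS => y.
Qed.

(** [contract] is continuous, real-valued and reflects the order, so the real extreme value theorem
    applies to its composite with [g]. *)
Lemma compact_ereal_EVT_max {T : topologicalType} {R : realType}
    (g : T -> \bar R) (K : set T) :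
  K !=set0 -> compact K -> continuous g ->
  exists2 x, K x & forall y, K y -> (g y <= g x)%E.
Proof.
move=> K0 cK cg.
have ccg : continuous (contract (R:=R) \o g).
  by move=> x; apply: continuous_comp; [exact: cg | exact: contract_continuous].
have [x xK xmax] := compact_EVT_max K0 cK (continuous_subspaceT ccg).
exists x => [|y yK]; first exact: set_mem.
by rewrite -le_contract; apply: xmax; exact: mem_set.
Qed.

(** Excluding the value [+oo] rules out the indeterminate sum of [+oo] and [-oo], the only obstacle
    to continuity of addition. *)
Lemma continuous_sume {T : topologicalType} {R : realType} {I : Type}
    (r : seq I) (F : I -> T -> \bar R) :
  (forall i x, (F i x < +oo)%E) -> (forall i, continuous (F i)) ->
  continuous (fun x => \sum_(i <- r) F i x)%E.
Proof.
move=> Foo cF; elim: r => [|i r IH] x.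
  by under eq_fun do rewrite big_nil; exact: cvg_cst.
rewrite /continuous_at; under eq_fun do rewrite big_cons; rewrite big_cons.
apply: cvgeD; [|exact: cF|exact: IH].
by apply: ltpinfty_adde_def; rewrite inE ?Foo // lte_sum_pinfty.
Qed.

(** * Extension of the increasing function [f] by its right limit at 0 *)

Section Extend0.
Context {R : realType} (f : R -> R).
Hypothesis f_cont : {within `]0, +oo[, continuous f}.
Hypothesis f_incr : {in `]0, +oo[ &, {homo f : x y / x < y}}.

(** By monotonicity the limit is the infimum of the values, which is at most [f 1]. *)
Lemma cvg_extend0_at_right0 : exists2 l : \bar R, (l < +oo)%E &
  (f y)%:E @[y --> 0^'+] --> l.
Proof.
exists (ereal_inf [set (f y)%:E | y in `]0, +oo[]).
  apply: (@le_lt_trans _ _ (f 1)%:E); last exact: ltry.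
  by apply: ereal_inf_lbound; exists 1 => //; rewrite /= in_itv /= ltr01.
apply: nondecreasing_at_right_cvge => // x y x0 y0; rewrite le_eqVlt lee_fin.
by move=> /predU1P[->//|/f_incr/ltW]; apply.
Qed.

Lemma extend0_lty x : (extend0 f x < +oo)%E.
Proof.
rewrite /extend0; case: ifP => _; first exact: ltry.
by have [l lty fl] := cvg_extend0_at_right0; rewrite (cvg_lim _ fl).
Qed.

(** The extension is constantly [l] on the nonpositive reals, so it is continuous on the whole line;
    at 0 the two one-sided limits are compared. *)
Lemma extend0_continuous : continuous (extend0 f).
Proof.
have [l _ fl] := cvg_extend0_at_right0.
have e0 x : x <= 0 -> extend0 f x = l.
  by move=> x0; rewrite /extend0 ltNge x0 (cvg_lim _ fl).
move=> x; have [x0|x0|->] := ltgtP x 0.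
- apply: (near_cst_continuous l); near=> y; apply: e0.
  by apply: ltW; near: y; exact: lt_nbhsl.
- rewrite /continuous_at {2}/extend0 x0.
  have fx : (f y)%:E @[y --> x] --> (f x)%:E.
    apply: cvg_EFin; first exact: nearW.
    move: f_cont; rewrite continuous_open_subspace //; apply.
    by rewrite inE /= in_itv /= x0.
  apply: cvg_trans fx; apply: near_eq_cvg; near=> y.
  by rewrite /extend0 ifT //; near: y; exact: lt_nbhsr.
apply/left_right_continuousP; rewrite e0 //; split.
  apply: cvg_near_cst; near=> y; apply: e0.
  by apply: ltW; near: y; exact: nbhs_left_lt.
apply: cvg_trans fl; apply: near_eq_cvg; near=> y.
by rewrite /extend0 ifT //; near: y; exact: nbhs_right_gt.
Unshelve. all: by end_near. Qed.

End Extend0.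

(** * The compact space of vertex tuples and its energy *)

Section Configurations.
Context {R : realType} (n : nat).
Implicit Types x : 'rV[R]_(n.+1 * 3).

(* The rows of [vec_mx x] are the [n.+1] points of the tuple; [point x k]
   is the point of index [k] modulo [n.+1]. *)
Definition point x (k : int) : 'rV[R]_3 :=
  row (inord `|(k %% n.+1)%Z|) (vec_mx x).

Lemma pointE x k j : point x k 0 j = x 0 (mxvec_index (inord `|(k %% n.+1)%Z|) j).
Proof. by rewrite !mxE. Qed.

Lemma point_periodic x k : point x (k + n.+1%:Z) = point x k.
Proof. by rewrite /point modzDr. Qed.

Lemma point_mod x k : point x (k %% n.+1)%Z = point x k.
Proof. by rewrite /point modz_mod. Qed.

Lemma eucl_dist_point_continuous k l :
  continuous (fun x => eucl_dist (point x k) (point x l)).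
Proof.
have sum_cont : continuous
    (fun x => \sum_(i < 3) (point x k 0 i - point x l 0 i) ^+ 2).
  apply: continuous_big => [|i _ x]; first exact: add_continuous.
  have coord_cont m : continuous (fun x => point x m 0 i).
    rewrite (_ : (fun x => point x m 0 i) = (fun x => x 0
      (mxvec_index (inord `|(m %% n.+1)%Z|) i))); first exact: coord_continuous.
    by apply/funext => z; rewrite pointE.
  exact: continuous_comp (cvgB (coord_cont k x) (coord_cont l x))
    (@exprn_continuous R 2 _).
by move=> x; apply: continuous_comp; [exact: sum_cont | exact: sqrt_continuous].
Qed.

(** The box provides compactness. It contains the vertices of every closed curve of length [n.+1]
    once the vertex of index 0 is moved to the origin. *)
Definition configurations : set 'rV[R]_(n.+1 * 3) :=
  [set x : 'rV[R]_(n.+1 * 3) | forall i, x 0 i \in `[- n.+1%:R, n.+1%:R]] `&`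
  \bigcap_k [set x | eucl_dist (point x k) (point x (k + 1)) <= 1].

Lemma configurations_compact : compact configurations.
Proof.
apply: compact_closedI.
  have := @rV_compact R _ (fun=> [set` `[- n.+1%:R, n.+1%:R]])
    (fun _ : 'I_(n.+1 * 3) => @segment_compact R _ _).
  exact.
apply: closed_bigI => k _; apply: closed_comp (closed_le (y := 1)) => x _.
exact: eucl_dist_point_continuous.
Qed.

Lemma configurations_nonempty : configurations !=set0.
Proof.
exists 0; split=> [i|k _] /=; first by rewrite mxE in_itv /= oppr_le0 ler0n.
rewrite (_ : point 0 _ = point 0 k) ?eucl_distxx //.
by apply/rowP => j; rewrite !pointE !mxE.
Qed.

Lemma configuration_of_curve c : closed_curves n.+1 c ->
  exists2 x, configurations x & forall k : nat, point x k = vertex c k - c 0.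
Proof.
move=> [cper clen].
(* A chord is no longer than its arc. This gives both the box bound and the bound on consecutive
   distances. *)
have lip (s t : R) : s <= t -> eucl_dist (c s) (c t) <= t - s.
  rewrite le_eqVlt => /predU1P[->|st]; first by rewrite eucl_distxx subrr.
  by rewrite -lee_fin -clen //; exact: eucl_dist_le_curve_length.
pose x : 'rV[R]_(n.+1 * 3) := mxvec (\matrix_(i, j) (c i%:R - c 0) 0 j).
have xE (k : nat) : point x k = vertex c k - c 0.
  have ck : c (k %% n.+1)%:R = vertex c k.
    rewrite /vertex [in RHS](divn_eq k n.+1) addnC natrD natrM mulr_natl.
    by rewrite periodicn.
  apply/rowP => j; rewrite pointE mxvecE [LHS]mxE modz_nat absz_nat.
  by rewrite inordK ?ltn_pmod // ck.
exists x => //; split=> [i|k _] /=.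
  case/mxvec_indexP: i => i j; rewrite mxvecE !mxE in_itv /= -ler_norml distrC.
  apply: le_trans (coord_le_eucl_dist _ _ _) _; apply: le_trans (lip _ _ (ler0n _ _)) _.
  by rewrite subr0 ler_nat ltnW.
(* [k] may be negative while [xE] concerns natural indices, so [k] is replaced by its residue
   [r]. *)
rewrite -(point_mod x k) -(point_mod x (k + 1)) -modzDml.
have [r ->] : exists r : nat, (k %% n.+1)%Z = r.
  by exists `|(k %% n.+1)%Z|%N; rewrite gez0_abs // modz_ge0.
rewrite (point_mod x (r%:Z + 1)) [r%:Z + 1]addrC -intS !xE eucl_dist_translate /vertex.
by apply: le_trans (lip _ _ _) _; rewrite -natr1 ?lerDl // addrC addKr.
Qed.

Definition configuration_energy (f : R -> R) x : \bar R :=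
  (\sum_(1 <= p < n.+2) \sum_(p.+1 <= q < n.+2)
     extend0 f (eucl_dist (point x p) (point x q)))%E.

Lemma energy_configuration f c x v :
  (forall k : nat, vertex c k = point x k + v) ->
  energy f n.+1 c = configuration_energy f x.
Proof.
move=> cx; apply: eq_bigr => p _; apply: eq_bigr => q _.
by rewrite !cx eucl_dist_translate.
Qed.

Lemma configuration_energy_continuous (f : R -> R) :
  {within `]0, +oo[, continuous f} ->
  {in `]0, +oo[ &, {homo f : x y / x < y}} ->
  continuous (configuration_energy f).
Proof.
move=> f_cont f_incr; apply: continuous_sume => [p x|p].
  by apply: lte_sum_pinfty => q _; exact: extend0_lty.
apply: continuous_sume => [q x|q x]; first exact: extend0_lty.
exact: continuous_comp (eucl_dist_point_continuous p q x)
  (extend0_continuous f f_cont f_incr _).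
Qed.

End Configurations.

Theorem theorem2p1 (R : realType) (n : nat) (hn : (1 <= n)%N) (f : R -> R)
    (f_cont : {within `]0, +oo[, continuous f})
    (f_incr : {in `]0, +oo[ &, {homo f : x y / x < y}}) :
  exists2 c' : R -> 'rV[R]_3, closed_curves n c' &
    forall c : R -> 'rV[R]_3, closed_curves n c ->
      (energy f n c <= energy f n c')%E.
Proof.
case: n hn => // n _.
have [x [_ x1] xmax] := compact_ereal_EVT_max _ _ (configurations_nonempty n)
  (configurations_compact n) (configuration_energy_continuous n f f_cont f_incr).
have [c' c'_closed c'x] := exists_closed_curve_through n.+1 (point n x)
  (point_periodic n x) (fun k => x1 k I).
exists c' => // c /configuration_of_curve[y yK yc].
(* The vertices of [c] are the points of [y] translated by [c 0]; those of [c'] are the points of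
   [x] themselves. *)
rewrite (energy_configuration n f c y (c 0)) => [|k]; last by rewrite yc subrK.
by rewrite (energy_configuration n f c' x 0) => [|k]; [exact: xmax | rewrite addr0].
Qed.
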